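(* Let $(A,\star)$ be an anti-associative algebra, $(V,\varrho,\mu)$ a representation of $(A,\star)$, and $\mathcal{K}:V\to A$ an embedding tensor on $(A,\star)$ with respect to $(V,\varrho,\mu)$. Then $V$ carries an anti-associative dialgebra structure $(V,\triangleright_{\mathcal{K}},\triangleleft_{\mathcal{K}})$ given by $$u\triangleright_{\mathcal{K}}v=\varrho(\mathcal{K}u)v,\qquad u\triangleleft_{\mathcal{K}}v=\mu(\mathcal{K}v)u,\qquad \forall u,v\in V.$$
   Context: All vector spaces and algebras are finite dimensional over a field $\mathbb{K}$ of characteristic zero. An anti-associative algebra $(A,\star)$ is a vector space with a bilinear product satisfying $(x\star y)\star z+x\star(y\star z)=0$ for all $x,y,z\in A$. A representation of $(A,\star)$ is a triple $(V,\varrho,\mu)$ with $V$ a vector space and $\varrho,\mu:A\to\mathrm{End}(V)$ linear maps satisfying, for all $x,y\in A$, $\varrho(x)\varrho(y)=-\varrho(x\star y)$, $\mu(y)\mu(x)=-\mu(x\star y)$, $\mu(x)\varrho(y)=-\varrho(y)\mu(x)$. An embedding tensor on $(A,\star)$ with respect to $(V,\varrho,\mu)$ is a linear map $\mathcal{K}:V\to A$ with $\mathcal{K}(u)\star\mathcal{K}(v)=\mathcal{K}(\varrho(\mathcal{K}(u))v)=\mathcal{K}(\mu(\mathcal{K}(v))u)$ for all $u,v\in V$. An anti-associative dialgebra $(D,\triangleright,\triangleleft)$ is a vector space with two bilinear operations satisfying, for all $x,y,z\in D$: $(x\triangleleft y)\triangleleft z+x\triangleleft(y\triangleleft z)=0$,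 $(x\triangleright y)\triangleright z+x\triangleright(y\triangleright z)=0$, and $(x\triangleright y)\triangleleft z+x\triangleright(y\triangleleft z)=0$. *)

(* Defs.v *)
From HB Require Import structures.
From mathcomp Require Import all_boot all_order all_algebra.

Set Implicit Arguments.
Unset Strict Implicit.
Unset Printing Implicit Defensive.

Import GRing.Theory.
Local Open Scope ring_scope.

(* A [vectType F] is a finite-dimensional vector space over F, so every
   algebra, dialgebra and representation below is finite dimensional. *)

Record antiassoc_algebra (F : fieldType) (A : vectType F)
    (star : A -> A -> A) : Prop := AntiassocAlgebra {
  aa_bilinear : bilinear_for *:%R *:%R star;
  aa_assoc : forall x y z : A, star (star x y) z + star x (star y z) = 0
}.

Record antiassoc_representation (F : fieldType) (A V : vectType F)
    (star : A -> A -> A) (rho mu : {linear A -> 'End(V)}) : Prop :=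
    AntiassocRepresentation {
  repr_left : forall x y : A, (rho x \o rho y)%VF = - rho (star x y);
  repr_right : forall x y : A, (mu y \o mu x)%VF = - mu (star x y);
  repr_mixed : forall x y : A, (mu x \o rho y)%VF = - (rho y \o mu x)%VF
}.

Record embedding_tensor (F : fieldType) (A V : vectType F)
    (star : A -> A -> A) (rho mu : {linear A -> 'End(V)})
    (K : 'Hom(V, A)) : Prop := EmbeddingTensor {
  embed_left : forall u v : V, star (K u) (K v) = K (rho (K u) v);
  embed_right : forall u v : V, star (K u) (K v) = K (mu (K v) u)
}.

(* [rprod] is the operation written with the right-pointing triangle and
   [lprod] the one written with the left-pointing triangle. *)
Record antiassoc_dialgebra (F : fieldType) (D : vectType F)
    (rprod lprod : D -> D -> D) : Prop := AntiassocDialgebra {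
  di_rprod_bilinear : bilinear_for *:%R *:%R rprod;
  di_lprod_bilinear : bilinear_for *:%R *:%R lprod;
  di_ll : forall x y z : D, lprod (lprod x y) z + lprod x (lprod y z) = 0;
  di_rr : forall x y z : D, rprod (rprod x y) z + rprod x (rprod y z) = 0;
  di_rl : forall x y z : D, lprod (rprod x y) z + rprod x (lprod y z) = 0
}.

(* Main.v *)
Require Import Defs.
From HB Require Import structures.
From mathcomp Require Import all_boot all_order all_algebra.

Set Implicit Arguments.
Unset Strict Implicit.
Unset Printing Implicit Defensive.

Import GRing.Theory.
Local Open Scope ring_scope.

(** Each dialgebra identity is one of the representation identities evaluated
    at a vector. The embedding tensor axioms say exactly that [K] sends both
    products [rho (K u) v] and [mu (K v) u] to [star (K u) (K v)], so an
    iterated product in which [K] is applied to an inner product becomes the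
    action of a [star]-product. The two one-sided identities are then the
    compatibility of [rho], respectively [mu], with [star]. The mixed identity
    never applies [K] to a product: it is the anticommutation of the operators
    [mu (K z)] and [rho (K x)]. *)

Lemma linear_action_bilinear (F : fieldType) (A V : vectType F)
    (phi : {linear A -> 'End(V)}) (K : 'Hom(V, A)) :
  bilinear_for *:%R *:%R (fun u v : V => phi (K u) v).
Proof.
split=> [v a x y | u a x y] /=; last by rewrite linearP.
by rewrite !linearP add_lfunE scale_lfunE.
Qed.

Theorem proposition3p12 (F : fieldType) (charF0 : [pchar F] =i pred0)
    (A V : vectType F) (star : A -> A -> A) (rho mu : {linear A -> 'End(V)})
    (K : 'Hom(V, A))
    (A_alg : antiassoc_algebra star)
    (V_repr : antiassoc_representation star rho mu)
    (K_emb : embedding_tensor star rho mu K) :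
  antiassoc_dialgebra (fun u v : V => rho (K u) v) (fun u v : V => mu (K v) u).
Proof.
have [rho_star mu_star mu_rho] := V_repr; have [K_rho K_mu] := K_emb.
split=> [| | x y z | x y z | x y z].
- exact: linear_action_bilinear.
- have [linl linr] := linear_action_bilinear mu K.
  by split=> [v | u]; [apply: linr | apply: linl].
- by rewrite -K_mu -comp_lfunE mu_star opp_lfunE addNr.
- by rewrite -K_rho -[rho (K x) _]comp_lfunE rho_star opp_lfunE subrr.
- by rewrite -!comp_lfunE mu_rho opp_lfunE addNr.
Qed.
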